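(* Let $A_1,A_2,A_3$ be three points in the Euclidean plane $\mathbb{R}^2$, and let $Q_1=Q(A_2,A_3)$, $Q_2=Q(A_1,A_3)$ and $Q_3=Q(A_1,A_2)$. Then $A_1,A_2,A_3$ are collinear if and only if $$\left(Q_1+Q_2+Q_3\right)^{2}=2\left(Q_1^{2}+Q_2^{2}+Q_3^{2}\right).$$
   Context: The quadrance between points $A=[x_1,y_1]$ and $B=[x_2,y_2]$ of the real Euclidean plane is $Q(A,B)=(x_2-x_1)^2+(y_2-y_1)^2$. *)

(* Defs.v *)
From mathcomp Require Import all_boot all_order all_algebra.
From mathcomp Require Import reals.

Set Implicit Arguments.
Unset Strict Implicit.
Unset Printing Implicit Defensive.

Import Order.TTheory GRing.Theory Num.Theory.
Local Open Scope ring_scope.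

(* A point [x, y] of the plane is a row vector A with x = A 0 0 and y = A 0 1. *)
Definition quadrance (R : realType) (A B : 'rV[R]_2) : R :=
  (B 0 0 - A 0 0) ^+ 2 + (B 0 1 - A 0 1) ^+ 2.

Definition on_line (R : realType) (a b c : R) (P : 'rV[R]_2) : Prop :=
  a * P 0 0 + b * P 0 1 + c = 0.

(* The points are not required to be distinct; a x + b y + c = 0 is the equation
   of a line exactly when (a, b) is not (0, 0). *)
Definition collinear (R : realType) (A1 A2 A3 : 'rV[R]_2) : Prop :=
  exists a b c : R,
    (a != 0 \/ b != 0) /\
    [/\ on_line a b c A1, on_line a b c A2 & on_line a b c A3].

(* Main.v *)
Require Import Defs.
From mathcomp Require Import all_boot all_order all_algebra.
From mathcomp Require Import reals.
From mathcomp Require Import ring.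

(** The identity behind the theorem is Heron's formula in terms of quadrances:
    [(Q1 + Q2 + Q3)^2 - 2 (Q1^2 + Q2^2 + Q3^2) = 4 D^2], where [D] is twice the
    signed area of the triangle, that is, the determinant of the two edge
    vectors leaving [A1] (lemma [heron_quadrance]).  So the equation between
    quadrances says exactly that [D = 0].

    It remains to see that [D = 0] means collinearity (lemma
    [collinear_cross0]).  A line through [A1] with normal vector [(a, b)]
    contains [A2] and [A3] exactly when [(a, b)] is orthogonal to both edge
    vectors, and a nonzero vector orthogonal to two given vectors of the plane
    exists exactly when their determinant vanishes
    (lemma [common_normal_det0]). *)

Set Implicit Arguments.
Unset Strict Implicit.
Unset Printing Implicit Defensive.

Import Order.TTheory GRing.Theory Num.Theory.
Local Open Scope ring_scope.

(** Twice the signed area of the triangle [A B C]. *)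
Definition cross (R : realType) (A B C : 'rV[R]_2) : R :=
  (B 0 0 - A 0 0) * (C 0 1 - A 0 1) - (B 0 1 - A 0 1) * (C 0 0 - A 0 0).

(** By Cramer's rule a common normal vector is annihilated by the determinant,
    which must vanish if the normal is nonzero.  Conversely, when the
    determinant is zero, a quarter turn of either vector is orthogonal to both,
    and it can serve as the normal as soon as that vector is nonzero. *)
Lemma common_normal_det0 (F : fieldType) (u1 u2 v1 v2 : F) :
  (exists a b : F, [/\ a != 0 \/ b != 0,
                       a * u1 + b * u2 = 0 & a * v1 + b * v2 = 0])
  <-> u1 * v2 - u2 * v1 = 0.
Proof.
split=> [[a [b [ab_neq0 hu hv]]] | det0].
  have ha : a * (u1 * v2 - u2 * v1) = 0.
    have -> : a * (u1 * v2 - u2 * v1) =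
              (a * u1 + b * u2) * v2 - (a * v1 + b * v2) * u2 by ring.
    by rewrite hu hv; ring.
  have hb : b * (u1 * v2 - u2 * v1) = 0.
    have -> : b * (u1 * v2 - u2 * v1) =
              (a * v1 + b * v2) * u1 - (a * u1 + b * u2) * v1 by ring.
    by rewrite hu hv; ring.
  by case: ab_neq0 => [/mulfI|/mulfI]; apply; rewrite mulr0.
have turn_u : u2 != 0 \/ - u1 != 0 -> exists a b : F,
    [/\ a != 0 \/ b != 0, a * u1 + b * u2 = 0 & a * v1 + b * v2 = 0].
  move=> u_neq0; exists u2, (- u1); split=> //; first by ring.
  by rewrite -oppr0 -[in RHS]det0; ring.
have [u2_eq0 | /or_introl/turn_u//] := eqVneq u2 0.
have [u1_eq0 | u1_neq0] := eqVneq u1 0; last first.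
  by apply: turn_u; right; rewrite oppr_eq0.
rewrite u1_eq0 u2_eq0.
have [v2_eq0 | v2_neq0] := eqVneq v2 0; last first.
  by exists v2, (- v1); split; [left | ring | ring].
(* The first vector is now zero and the second one lies on the first axis. *)
by exists 0, 1; split; [right; exact: oner_neq0 | ring | rewrite v2_eq0; ring].
Qed.

(** The constant term of the equation of a line is determined by the normal
    vector and one point [A] of the line; eliminating it leaves the condition
    that the normal is orthogonal to the edges leaving [A]. *)
Lemma collinear_cross0 (R : realType) (A B C : 'rV[R]_2) :
  collinear A B C <-> cross A B C = 0.
Proof.
apply: iff_trans (common_normal_det0 _ _ _ _).
split=> [[a [b [c [ab_neq0 [hA hB hC]]]]] | [a [b [ab_neq0 hB hC]]]].
  exists a, b; split=> //.
    by have := congr2 (fun s t => s - t) hB hA; rewrite subrr => <-; ring.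
  by have := congr2 (fun s t => s - t) hC hA; rewrite subrr => <-; ring.
exists a, b, (- (a * A 0 0 + b * A 0 1)); split=> //.
by split; rewrite /on_line; [ring | rewrite -hB; ring | rewrite -hC; ring].
Qed.

(** Heron's formula: with side lengths in place of quadrances, the left-hand
    side factors as [(a + b + c) (- a + b + c) (a - b + c) (a + b - c)], which
    is 16 times the squared area. *)
Lemma heron_quadrance (R : realType) (A B C : 'rV[R]_2) :
  (quadrance B C + quadrance A C + quadrance A B) ^+ 2
  - 2 * (quadrance B C ^+ 2 + quadrance A C ^+ 2 + quadrance A B ^+ 2)
  = 4 * cross A B C ^+ 2.
Proof. by rewrite /quadrance /cross; ring. Qed.

Theorem theorem4 (R : realType) (A1 A2 A3 : 'rV[R]_2) (Q1 Q2 Q3 : R)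
    (hQ1 : Q1 = quadrance A2 A3)
    (hQ2 : Q2 = quadrance A1 A3)
    (hQ3 : Q3 = quadrance A1 A2) :
  collinear A1 A2 A3 <->
  (Q1 + Q2 + Q3) ^+ 2 = 2 * (Q1 ^+ 2 + Q2 ^+ 2 + Q3 ^+ 2).
Proof.
apply: iff_trans (collinear_cross0 _ _ _) _.
have := heron_quadrance A1 A2 A3; rewrite -hQ1 -hQ2 -hQ3 => heron.
split=> [cross0 | /eqP].
  by apply/eqP; rewrite -subr_eq0 heron cross0 expr0n mulr0.
by rewrite -subr_eq0 heron mulf_eq0 pnatr_eq0 sqrf_eq0 => /eqP.
Qed.
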